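(* Let $\mathscr T$ be a triangulated category with a non-degenerate t-structure $(\mathscr T_{\le0},\mathscr T_{\ge0})$ which admits a left adjacent co-t-structure $(\mathscr T^w_{\ge0},\mathscr T^w_{\le0})$, i.e. one with $\mathscr T^w_{\le0}=\mathscr T_{\le0}$, such that the co-heart $\mathscr T^w_{\ge0}\cap\mathscr T^w_{\le0}$ is idempotent complete. Then $\mathscr T$ has enough derived projectives, and the derived projectives coincide with the co-heart: $$\mathrm{DGProj}(\mathscr T)=\mathscr T^w_{\ge0}\cap\mathscr T^w_{\le0}.$$
   Context: Everything is linear over a fixed commutative ring $\mathbf k$. For a t-structure $(\mathscr T_{\le0},\mathscr T_{\ge0})$ on $\mathscr T$ (with $\mathscr T_{\le n}=\mathscr T_{\le0}[-n]$, $\mathscr T_{\ge n}=\mathscr T_{\ge0}[-n]$), the heart is $\mathscr T^\heartsuit=\mathscr T_{\le0}\cap\mathscr T_{\ge0}$, $H^0\colon\mathscr T\to\mathscr T^\heartsuit$ is the associated cohomological functor and $H^n(-)=H^0(-[n])$. The t-structure is non-degenerate if $A\cong0$ is equivalent to $H^n(A)\cong0$ for all $n\in\mathbb Z$. A co-t-structure on $\mathscr T$ is a pair $(\mathscr T^w_{\ge 0},\mathscr T^w_{\le 0})$ of full additive subcategories closed under isomorphisms and direct summands such that, with $\mathscr T^w_{\ge n}=\mathscr T^w_{\ge 0}[-n]$ and $\mathscr T^w_{\le n}=\mathscr T^w_{\le 0}[-n]$: $\mathscr T^w_{\ge 1}\subseteq \mathscr T^w_{\ge 0}$ and $\mathscr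 T^w_{\le -1}\subseteq\mathscr T^w_{\le 0}$; $\mathscr T(X,Y)=0$ for $X\in\mathscr T^w_{\ge 0}$, $Y\in\mathscr T^w_{\le -1}$; every $X\in\mathscr T$ fits in a distinguished triangle $\sigma_{\ge0}X\to X\to\sigma_{\le-1}X\to(\sigma_{\ge 0}X)[1]$ with $\sigma_{\ge0}X\in\mathscr T^w_{\ge 0}$, $\sigma_{\le-1}X\in\mathscr T^w_{\le -1}$. Its co-heart is $\mathscr T^w_{\ge0}\cap\mathscr T^w_{\le0}$. For a projective object $P$ of the abelian category $\mathscr T^\heartsuit$, the derived projective associated to $P$, if it exists, is an object $S(P)\in\mathscr T$ with a natural isomorphism $\mathscr T^\heartsuit(P,H^0(-))\cong\mathscr T(S(P),-)$. An object is derived projective if it is isomorphic to $S(P)$ for some projective $P\in\mathscr T^\heartsuit$; $\mathrm{DGProj}(\mathscr T)$ is the full subcategory of derived projectives. $\mathscr T$ has derived projectives if $S(P)$ exists for every projective $P\in\mathscr T^\heartsuit$; it has enough derived projectives if moreover $\mathscr T^\heartsuit$ has enough projectives. *)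

(* Defs.v *)
From mathcomp Require Import all_boot all_order all_algebra.
From mathcomp Require Import boolp.

Set Implicit Arguments.
Unset Strict Implicit.
Unset Printing Implicit Defensive.

Import GRing.Theory.
Local Open Scope ring_scope.

Reserved Notation "g \co f" (at level 40, left associativity).

(* k-linear categories.  lmodType also demands a choice operator on Hom sets;
   by the axiom of choice in boolp every type has one. *)
Record lincat (k : comPzRingType) := LinCat {
  obj :> Type;
  Hom : obj -> obj -> lmodType k;
  idmor : forall X, Hom X X;
  hcomp : forall X Y Z, Hom Y Z -> Hom X Y -> Hom X Z;
  hcomp_idl : forall X Y (f : Hom X Y), hcomp (idmor Y) f = f;
  hcomp_idr : forall X Y (f : Hom X Y), hcomp f (idmor X) = f;
  hcompA : forall X Y Z W (h : Hom Z W) (g : Hom Y Z) (f : Hom X Y),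
    hcomp h (hcomp g f) = hcomp (hcomp h g) f;
  hcomp_linl : forall X Y Z (f : Hom X Y),
    linear (fun g : Hom Y Z => hcomp g f);
  hcomp_linr : forall X Y Z (g : Hom Y Z),
    linear (fun f : Hom X Y => hcomp g f)
}.

Arguments Hom {k l} X Y.
Arguments idmor {k l} X.
Arguments hcomp {k l X Y Z} g f.
Notation "g \co f" := (hcomp g f) : ring_scope.

Section Categories.
Variables (k : comPzRingType) (C : lincat k).
Implicit Types X Y Z : C.

Definition inverses X Y (f : Hom X Y) (g : Hom Y X) : Prop :=
  g \co f = idmor X /\ f \co g = idmor Y.

Definition is_isomor X Y (f : Hom X Y) : Prop := exists g, inverses f g.

Definition isomorphic X Y : Prop := exists f : Hom X Y, is_isomor f.

(* Initial and terminal. *)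
Definition is_zero X : Prop :=
  forall Y, (forall f : Hom X Y, f = 0) /\ (forall f : Hom Y X, f = 0).

Definition biproduct X Y Z (i : Hom X Z) (j : Hom Y Z)
    (p : Hom Z X) (q : Hom Z Y) : Prop :=
  [/\ p \co i = idmor X, q \co j = idmor Y, q \co i = 0, p \co j = 0
    & i \co p + j \co q = idmor Z].

Definition additive_cat : Prop :=
  (exists X, is_zero X) /\
  (forall X Y, exists Z (i : Hom X Z) (j : Hom Y Z) (p : Hom Z X) (q : Hom Z Y),
     biproduct i j p q).

Definition direct_summand X Z : Prop :=
  exists Y (i : Hom X Z) (j : Hom Y Z) (p : Hom Z X) (q : Hom Z Y),
    biproduct i j p q.

Definition iso_closed (P : C -> Prop) : Prop :=
  forall X Y, isomorphic X Y -> P X -> P Y.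

Definition summand_closed (P : C -> Prop) : Prop :=
  forall X Z, direct_summand X Z -> P Z -> P X.

Definition idempotent_complete : Prop :=
  forall X (e : Hom X X), e \co e = e ->
    exists Y (i : Hom Y X) (p : Hom X Y), p \co i = idmor Y /\ i \co p = e.

Definition epi X Y (f : Hom X Y) : Prop :=
  forall Z (u v : Hom Y Z), u \co f = v \co f -> u = v.

Definition projective (P : C) : Prop :=
  forall X Y (e : Hom X Y), epi e ->
    forall f : Hom P Y, exists g : Hom P X, e \co g = f.

Definition enough_projectives : Prop :=
  forall X, exists (P : C) (e : Hom P X), projective P /\ epi e.

Definition full_subcat (P : C -> Prop) : lincat k :=
  @LinCat k {X : C | P X}
    (fun A B => Hom (sval A) (sval B)) (fun A => idmor (sval A))
    (fun _ _ _ g f => g \co f)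
    (fun _ _ f => hcomp_idl f) (fun _ _ f => hcomp_idr f)
    (fun _ _ _ _ h g f => hcompA h g f)
    (fun _ _ B f => @hcomp_linl _ C _ _ (sval B) f)
    (fun A _ _ g => @hcomp_linr _ C (sval A) _ _ g).

Lemma hcomp0l X Y Z (f : Hom X Y) : (0 : Hom Y Z) \co f = 0.
Proof.
have /(_ (-1) 0 0) := @hcomp_linl _ C _ _ Z f.
by rewrite scaler0 addr0 scaleN1r addNr.
Qed.

Lemma hcomp0r X Y Z (g : Hom Y Z) : g \co (0 : Hom X Y) = 0.
Proof.
have /(_ (-1) 0 0) := @hcomp_linr _ C X _ _ g.
by rewrite scaler0 addr0 scaleN1r addNr.
Qed.

Lemma hcompDl X Y Z (g g' : Hom Y Z) (f : Hom X Y) :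
  (g + g') \co f = g \co f + g' \co f.
Proof. by have := @hcomp_linl _ C _ _ Z f 1 g g'; rewrite !scale1r. Qed.

Lemma hcompDr X Y Z (g : Hom Y Z) (f f' : Hom X Y) :
  g \co (f + f') = g \co f + g \co f'.
Proof. by have := @hcomp_linr _ C X _ _ g 1 f f'; rewrite !scale1r. Qed.

Lemma hcompNl X Y Z (g : Hom Y Z) (f : Hom X Y) : (- g) \co f = - (g \co f).
Proof. by apply/eqP; rewrite -addr_eq0 -hcompDl addNr hcomp0l. Qed.

Lemma hcompNr X Y Z (g : Hom Y Z) (f : Hom X Y) : g \co (- f) = - (g \co f).
Proof. by apply/eqP; rewrite -addr_eq0 -hcompDr addNr hcomp0r. Qed.

Lemma hcompBl X Y Z (g g' : Hom Y Z) (f : Hom X Y) :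
  (g - g') \co f = g \co f - g' \co f.
Proof. by rewrite hcompDl hcompNl. Qed.

Lemma hcompBr X Y Z (g : Hom Y Z) (f f' : Hom X Y) :
  g \co (f - f') = g \co f - g \co f'.
Proof. by rewrite hcompDr hcompNr. Qed.

Lemma is_zeroP X : is_zero X <-> idmor X = 0.
Proof.
split=> [/(_ X)[X0 _]|X0 Y]; first exact: X0.
split=> f.
  by rewrite -[f]hcomp_idr X0 hcomp0r.
by rewrite -[f]hcomp_idl X0 hcomp0l.
Qed.

Lemma iso_sym X Y : isomorphic X Y -> isomorphic Y X.
Proof. by move=> [f [g [gf fg]]]; exists g, f. Qed.

Lemma iso_trans Y X Z : isomorphic X Y -> isomorphic Y Z -> isomorphic X Z.
Proof.
move=> [f [g [gf fg]]] [f' [g' [gf' fg']]].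
exists (f' \co f), (g \co g'); split.
  by rewrite hcompA -(hcompA g) gf' hcomp_idr.
by rewrite hcompA -(hcompA f') fg hcomp_idr.
Qed.

Lemma idm_iso X : is_isomor (idmor X).
Proof. by exists (idmor X); split; rewrite hcomp_idl. Qed.

Lemma iso_refl X : isomorphic X X.
Proof. by exists (idmor X); apply: idm_iso. Qed.

End Categories.

Record functor (k : comPzRingType) (C D : lincat k) := Functor {
  fobj :> C -> D;
  fmor : forall X Y, Hom X Y -> Hom (fobj X) (fobj Y);
  fmor_id : forall X, fmor (idmor X) = idmor (fobj X);
  fmor_comp : forall X Y Z (g : Hom Y Z) (f : Hom X Y),
    fmor (g \co f) = fmor g \co fmor f;
  fmor_lin : forall X Y, linear (@fmor X Y)
}.

Arguments fmor {k C D} F {X Y} f : rename.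

Section Functors.
Variable k : comPzRingType.
Implicit Types C D : lincat k.

Definition id_fun C : functor C C :=
  @Functor k C C id (fun _ _ f => f)
    (fun _ => erefl) (fun _ _ _ _ _ => erefl) (fun _ _ _ _ _ => erefl).

Program Definition comp_fun C D E (G : functor D E) (F : functor C D) :
    functor C E :=
  @Functor k C E (fun X => G (F X)) (fun _ _ f => fmor G (fmor F f)) _ _ _.
Next Obligation. by rewrite !fmor_id. Qed.
Next Obligation. by rewrite !fmor_comp. Qed.
Next Obligation. by move=> a f g; rewrite !fmor_lin. Qed.

Definition fun_iso C D (F G : functor C D) : Prop :=
  exists eta : forall X, Hom (F X) (G X),
    (forall X, is_isomor (eta X)) /\
    (forall X Y (f : Hom X Y), eta Y \co fmor F f = fmor G f \co eta X).

Lemma fmorD C D (F : functor C D) X Y (f g : Hom X Y) :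
  fmor F (f + g) = fmor F f + fmor F g.
Proof. by have := @fmor_lin _ _ _ F X Y 1 f g; rewrite !scale1r. Qed.

Lemma fmor0 C D (F : functor C D) X Y : fmor F (0 : Hom X Y) = 0.
Proof.
have /(_ (-1) 0 0) := @fmor_lin _ _ _ F X Y.
by rewrite scaler0 addr0 scaleN1r addNr.
Qed.

Lemma fmorN C D (F : functor C D) X Y (f : Hom X Y) : fmor F (- f) = - fmor F f.
Proof. by apply/eqP; rewrite -addr_eq0 -fmorD addNr fmor0. Qed.

Lemma fmor_iso C D (F : functor C D) X Y :
  isomorphic X Y -> isomorphic (F X) (F Y).
Proof.
move=> [f [g [gf fg]]]; exists (fmor F f), (fmor F g).
by split; rewrite -fmor_comp ?gf ?fg fmor_id.
Qed.

End Functors.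

(* [dist f g h] says that X -f-> Y -g-> Z -h-> X[1] is distinguished.  The shift
   is an autoequivalence with quasi-inverse [unsh], not a strict automorphism.
   dist_iso, dist_id and dist_cone are Verdier's TR1, dist_rot is TR2,
   dist_fill is TR3 and dist_octa is the octahedral axiom TR4. *)
Record tricat (k : comPzRingType) := TriCat {
  tcat :> lincat k;
  tcat_additive : additive_cat tcat;
  sh : functor tcat tcat;
  unsh : functor tcat tcat;
  shK : fun_iso (comp_fun unsh sh) (id_fun tcat);
  unshK : fun_iso (comp_fun sh unsh) (id_fun tcat);
  dist : forall X Y Z : tcat, Hom X Y -> Hom Y Z -> Hom Z (sh X) -> Prop;
  dist_iso : forall X Y Z X' Y' Z' (f : Hom X Y) (g : Hom Y Z)
      (h : Hom Z (sh X)) (f' : Hom X' Y') (g' : Hom Y' Z')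
      (h' : Hom Z' (sh X')) (a : Hom X X') (b : Hom Y Y') (c : Hom Z Z'),
    is_isomor a -> is_isomor b -> is_isomor c ->
    b \co f = f' \co a -> c \co g = g' \co b -> fmor sh a \co h = h' \co c ->
    dist f g h -> dist f' g' h';
  dist_id : forall X Z : tcat, is_zero Z ->
    dist (idmor X) (0 : Hom X Z) (0 : Hom Z (sh X));
  dist_cone : forall X Y (f : Hom X Y),
    exists Z (g : Hom Y Z) (h : Hom Z (sh X)), dist f g h;
  dist_rot : forall X Y Z (f : Hom X Y) (g : Hom Y Z) (h : Hom Z (sh X)),
    dist f g h <-> dist g h (- fmor sh f);
  dist_fill : forall X Y Z X' Y' Z' (f : Hom X Y) (g : Hom Y Z)
      (h : Hom Z (sh X)) (f' : Hom X' Y') (g' : Hom Y' Z')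
      (h' : Hom Z' (sh X')) (a : Hom X X') (b : Hom Y Y'),
    dist f g h -> dist f' g' h' -> b \co f = f' \co a ->
    exists c : Hom Z Z', c \co g = g' \co b /\ fmor sh a \co h = h' \co c;
  dist_octa : forall X Y Z A B C (f : Hom X Y) (g : Hom Y Z)
      (f' : Hom Y A) (f'' : Hom A (sh X))
      (g' : Hom Z B) (g'' : Hom B (sh Y))
      (e' : Hom Z C) (e'' : Hom C (sh X)),
    dist f f' f'' -> dist g g' g'' -> dist (g \co f) e' e'' ->
    exists (u : Hom A C) (v : Hom C B),
      [/\ dist u v (fmor sh f' \co g''),
          u \co f' = e' \co g, e'' \co u = f'',
          v \co e' = g' & g'' \co v = fmor sh f \co e'']
}.

Section Triangulated.
Variables (k : comPzRingType) (T : tricat k).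
Implicit Types X Y Z : T.

(* X[n]. *)
Definition shiftn (n : int) X : T :=
  match n with
  | Posz m => iter m (sh T) X
  | Negz m => iter m.+1 (unsh T) X
  end.

(* The full subcategory P[n], closed under isomorphisms. *)
Definition shifted (P : T -> Prop) (n : int) : T -> Prop :=
  fun X => exists2 Y, P Y & isomorphic X (shiftn n Y).

(* Distinguished triangles A -> X -> B -> A[1] with A in P and B in Q. *)
Record decomposition (P Q : T -> Prop) X := Decomposition {
  dec_l : T;
  dec_r : T;
  dec_in : Hom dec_l X;
  dec_out : Hom X dec_r;
  dec_bd : Hom dec_r (sh T dec_l);
  dec_lP : P dec_l;
  dec_rP : Q dec_r;
  dec_dist : dist dec_in dec_out dec_bd
}.

(* T_{<=0}[1] = T_{<=-1} and T_{>=0}[-1] = T_{>=1}. *)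
Record tstruct := TStruct {
  tle0 : T -> Prop;
  tge0 : T -> Prop;
  tle0_iso : iso_closed tle0;
  tge0_iso : iso_closed tge0;
  tle_sub : forall X, shifted tle0 1 X -> tle0 X;
  tge_sub : forall X, shifted tge0 (-1) X -> tge0 X;
  t_orth : forall X Y, tle0 X -> shifted tge0 (-1) Y ->
    forall f : Hom X Y, f = 0;
  t_dec : forall X, inhabited (decomposition tle0 (shifted tge0 (-1)) X)
}.

Record cotstruct := CotStruct {
  wge0 : T -> Prop;
  wle0 : T -> Prop;
  wge0_additive : additive_cat (full_subcat wge0);
  wle0_additive : additive_cat (full_subcat wle0);
  wge0_iso : iso_closed wge0;
  wle0_iso : iso_closed wle0;
  wge0_summand : summand_closed wge0;
  wle0_summand : summand_closed wle0;
  wge_sub : forall X, shifted wge0 (-1) X -> wge0 X;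
  wle_sub : forall X, shifted wle0 1 X -> wle0 X;
  w_orth : forall X Y, wge0 X -> shifted wle0 1 Y ->
    forall f : Hom X Y, f = 0;
  w_dec : forall X, inhabited (decomposition wge0 (shifted wle0 1) X)
}.

Definition in_coheart (w : cotstruct) X : Prop := wge0 w X /\ wle0 w X.

Definition coheart (w : cotstruct) : lincat k := full_subcat (in_coheart w).

Definition left_adjacent (t : tstruct) (w : cotstruct) : Prop :=
  forall X, wle0 w X <-> tle0 t X.

Lemma sh_faithful X Y (f : Hom X Y) : fmor (sh T) f = 0 -> f = 0.
Proof.
move=> f0; have [eta [etai etan]] := shK T.
have := etan _ _ f; rewrite /= f0 fmor0 hcomp0r => /esym e0.
have [g [_ eg]] := etai X.
by rewrite -[f]hcomp_idr -eg hcompA e0 hcomp0l.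
Qed.

Lemma unsh_faithful X Y (f : Hom X Y) : fmor (unsh T) f = 0 -> f = 0.
Proof.
move=> f0; have [eta [etai etan]] := unshK T.
have := etan _ _ f; rewrite /= f0 fmor0 hcomp0r => /esym e0.
have [g [_ eg]] := etai X.
by rewrite -[f]hcomp_idr -eg hcompA e0 hcomp0l.
Qed.

Lemma sh_full X Y (f : Hom (sh T X) (sh T Y)) :
  exists g : Hom X Y, fmor (sh T) g = f.
Proof.
have [eta [etai etan]] := shK T.
have [e' [e'K Ke']] := etai X.
exists (eta Y \co fmor (unsh T) f \co e').
apply/eqP; rewrite -subr_eq0; apply/eqP; apply: unsh_faithful.
rewrite fmorD fmorN.
set g := _ \co e'.
have := etan _ _ g; rewrite /= => eg.
have [i [iK Ki]] := etai Y.
have -> : fmor (unsh T) (fmor (sh T) g) = fmor (unsh T) f.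
  rewrite -[LHS]hcomp_idl -iK /= -hcompA eg /g hcompA -!hcompA e'K hcomp_idr.
  by rewrite hcompA iK hcomp_idl.
by rewrite subrr.
Qed.

Lemma sh_hom0 X Y (u : Hom (sh T X) Y) :
  (forall v : Hom X (unsh T Y), v = 0) -> u = 0.
Proof.
move=> v0; have [eta [etai _]] := unshK T; have [i [iK Ki]] := etai Y.
have [g gE] := sh_full (i \co u).
have u0 : i \co u = 0 by rewrite -gE (v0 g) fmor0.
by rewrite -[u]hcomp_idl -Ki -hcompA u0 hcomp0r.
Qed.

Lemma dist_comp0 X Y Z (f : Hom X Y) (g : Hom Y Z) (h : Hom Z (sh T X)) :
  dist f g h -> g \co f = 0.
Proof.
move=> d; have [[O O0] _] := tcat_additive T.
have [c [cE _]] := @dist_fill _ T _ _ _ _ _ _ _ _ _ _ _ _ (idmor X) f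
  (dist_id X O0) d erefl.
by rewrite -cE hcomp0r.
Qed.

Lemma dist_lift X Y Z (f : Hom X Y) (g : Hom Y Z) (h : Hom Z (sh T X))
    W (u : Hom W Y) :
  dist f g h -> g \co u = 0 -> exists v, f \co v = u.
Proof.
move=> d gu; have [[O O0] _] := tcat_additive T.
have /dist_rot d1 := dist_id W O0; have /dist_rot d2 := d.
have [|c [_ cE]] := @dist_fill _ T _ _ _ _ _ _ _ _ _ _ _ _ u (0 : Hom O Z) d1 d2.
  by rewrite gu hcomp0l.
have [v vE] := sh_full c; exists v.
move: cE; rewrite fmor_id hcompNr hcomp_idr hcompNl -vE => /oppr_inj.
rewrite -fmor_comp => e; apply/eqP; rewrite eq_sym -subr_eq0; apply/eqP.
by apply: sh_faithful; rewrite fmorD fmorN e subrr.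
Qed.

Lemma dist_desc X Y Z (f : Hom X Y) (g : Hom Y Z) (h : Hom Z (sh T X))
    W (u : Hom Y W) :
  dist f g h -> u \co f = 0 -> exists v, v \co g = u.
Proof.
move=> d uf; have [[O O0] _] := tcat_additive T.
have OS0 : is_zero (sh T O).
  by apply/is_zeroP; rewrite -fmor_id (is_zeroP O).1 // fmor0.
have d0 : dist (0 : Hom O W) (idmor W) (0 : Hom W (sh T O)).
  apply/dist_rot; rewrite fmor0 oppr0; exact: dist_id.
have [|c [cE _]] := @dist_fill _ T _ _ _ _ _ _ _ _ _ _ _ _ (0 : Hom X O) u d d0.
  by rewrite uf hcomp0l.
by exists c; rewrite cE hcomp_idl.
Qed.

Lemma dist_sh X Y Z (f : Hom X Y) (g : Hom Y Z) (h : Hom Z (sh T X)) :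
  dist f g h -> exists h', dist (fmor (sh T) f) (fmor (sh T) g) h'.
Proof.
move=> /dist_rot /dist_rot /dist_rot d; exists (- fmor (sh T) h).
have nidi W : is_isomor (- idmor W : Hom (W : T) W).
  by exists (- idmor W); split; rewrite hcompNr hcompNl hcomp_idl opprK.
apply: (dist_iso (idm_iso _) (nidi _) (idm_iso _) _ _ _ d).
- by rewrite hcompNl hcompNr hcomp_idl hcomp_idr opprK.
- by rewrite !hcompNr hcomp_idr hcomp_idl.
- by rewrite fmor_id hcomp_idl hcomp_idr.
Qed.

Section TStructure.
Variable t : tstruct.

Definition tle (n : int) : T -> Prop := shifted (tle0 t) (- n).
Definition tge (n : int) : T -> Prop := shifted (tge0 t) (- n).

Lemma tle_sh X : tle0 t X -> tle0 t (sh T X).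
Proof. by move=> tX; apply: tle_sub; exists X => //; apply: iso_refl. Qed.

Lemma tle_tge_m1 X Y (f : Hom X Y) : tle (-1) X -> tge0 t Y -> f = 0.
Proof.
move=> [X' tX [a [b [ba ab]]]] tY.
have tuY : shifted (tge0 t) (-1) (unsh T Y) by exists Y => //; apply: iso_refl.
have fb : f \co b = 0.
  by apply: sh_hom0 => v; apply: t_orth tX tuY v.
by rewrite -[f]hcomp_idr -ba hcompA fb hcomp0l.
Qed.

Lemma ge_dec_exists X : inhabited (decomposition (tle (-1)) (tge0 t) X).
Proof.
have [[A B f g h PA [B' QB iB] d]] := t_dec t (unsh T X).
have [eta [etai _]] := unshK T; have [i iK] := etai X.
have [h' d'] := dist_sh d.
have ei : is_isomor (eta X) by exists i.
split; exists (sh T A) (sh T B) (eta X \co fmor (sh T) f)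
    (fmor (sh T) g \co i) h'.
- by exists A => //; apply: iso_refl.
- apply: tge0_iso QB; apply: iso_sym.
  apply: iso_trans (fmor_iso (sh T) iB) _.
  by exists (eta B'); apply: etai.
- apply: (dist_iso (idm_iso _) ei (idm_iso _) _ _ _ d').
  + by rewrite hcomp_idr.
  + by rewrite hcomp_idl -hcompA (proj1 iK) hcomp_idr.
  + by rewrite fmor_id hcomp_idl hcomp_idr.
Qed.

(* Triangles tau_{<=0} X -> X -> tau_{>=1} X and
   tau_{<=-1} X -> X -> tau_{>=0} X chosen for every X; by [le_lift_uniq] and
   [ge_desc_uniq] they are unique up to unique isomorphism. *)
Definition le_dec X : decomposition (tle0 t) (tge 1) X :=
  inhabited_witness (t_dec t X).

Definition ge_dec X : decomposition (tle (-1)) (tge0 t) X :=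
  inhabited_witness (ge_dec_exists X).

Lemma le_lift_exists A X (u : Hom A X) : tle0 t A ->
  exists v, dec_in (le_dec X) \co v = u.
Proof.
move=> tA; apply: (dist_lift (dec_dist (le_dec X))).
exact: t_orth tA (dec_rP (le_dec X)) _.
Qed.

Lemma le_lift_uniq A X (v v' : Hom A (dec_l (le_dec X))) : tle0 t A ->
  dec_in (le_dec X) \co v = dec_in (le_dec X) \co v' -> v = v'.
Proof.
move=> tA e; apply/eqP; rewrite -subr_eq0; apply/eqP; apply: sh_faithful.
have /dist_rot/dist_rot d := dec_dist (le_dec X).
have [|w wE] := dist_lift (u := fmor (sh T) (v - v')) d.
  by rewrite hcompNl -fmor_comp hcompBr e subrr fmor0 oppr0.
have w0 := t_orth (tle_sh tA) (dec_rP (le_dec X)) w.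
by rewrite -wE w0 hcomp0r.
Qed.

Lemma ge_desc_exists X C (u : Hom X C) : tge0 t C ->
  exists v, v \co dec_out (ge_dec X) = u.
Proof.
move=> tC; apply: (dist_desc (dec_dist (ge_dec X))).
exact: tle_tge_m1 (dec_lP (ge_dec X)) tC.
Qed.

Lemma ge_desc_uniq X C (v v' : Hom (dec_r (ge_dec X)) C) : tge0 t C ->
  v \co dec_out (ge_dec X) = v' \co dec_out (ge_dec X) -> v = v'.
Proof.
move=> tC e; apply/eqP; rewrite -subr_eq0; apply/eqP.
have /dist_rot d := dec_dist (ge_dec X).
have [|w wE] := dist_desc (u := v - v') d.
  by rewrite hcompBl e subrr.
have tA : tle (-1) (sh T (dec_l (ge_dec X))).
  have [A' tA' iA] := dec_lP (ge_dec X).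
  by exists (sh T A'); [exact: tle_sh | exact: fmor_iso].
by rewrite -wE (tle_tge_m1 w tA tC) hcomp0l.
Qed.

Definition tau_le_map X Y (f : Hom X Y) :
    Hom (dec_l (le_dec X)) (dec_l (le_dec Y)) :=
  sval (cid (le_lift_exists (f \co dec_in (le_dec X)) (dec_lP (le_dec X)))).

Lemma tau_le_mapE X Y (f : Hom X Y) :
  dec_in (le_dec Y) \co tau_le_map f = f \co dec_in (le_dec X).
Proof. by rewrite /tau_le_map; case: cid. Qed.

Definition tau_ge_map X Y (f : Hom X Y) :
    Hom (dec_r (ge_dec X)) (dec_r (ge_dec Y)) :=
  sval (cid (ge_desc_exists (dec_out (ge_dec Y) \co f) (dec_rP (ge_dec Y)))).

Lemma tau_ge_mapE X Y (f : Hom X Y) :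
  tau_ge_map f \co dec_out (ge_dec X) = dec_out (ge_dec Y) \co f.
Proof. by rewrite /tau_ge_map; case: cid. Qed.

Program Definition tau_le : functor T T :=
  @Functor k T T (fun X => dec_l (le_dec X)) tau_le_map _ _ _.
Next Obligation.
apply: le_lift_uniq; first exact: dec_lP.
by rewrite tau_le_mapE hcomp_idl hcomp_idr.
Qed.
Next Obligation.
apply: le_lift_uniq; first exact: dec_lP.
by rewrite hcompA !tau_le_mapE -!hcompA tau_le_mapE.
Qed.
Next Obligation.
move=> a f g; apply: le_lift_uniq; first exact: dec_lP.
by rewrite hcomp_linr !tau_le_mapE hcomp_linl.
Qed.

Program Definition tau_ge : functor T T :=
  @Functor k T T (fun X => dec_r (ge_dec X)) tau_ge_map _ _ _.
Next Obligation.
apply: ge_desc_uniq; first exact: dec_rP.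
by rewrite tau_ge_mapE hcomp_idl hcomp_idr.
Qed.
Next Obligation.
apply: ge_desc_uniq; first exact: dec_rP.
by rewrite -hcompA !tau_ge_mapE !hcompA tau_ge_mapE.
Qed.
Next Obligation.
move=> a f g; apply: ge_desc_uniq; first exact: dec_rP.
by rewrite hcomp_linl !tau_ge_mapE hcomp_linr.
Qed.

Lemma tle0_orth X :
  (forall Y (f : Hom X Y), tge 1 Y -> f = 0) -> tle0 t X.
Proof.
move=> X0; set D := le_dec X.
have [|s sE] := dist_lift (u := idmor X) (dec_dist D).
  by rewrite (X0 _ (dec_out D) (dec_rP D)) hcomp0l.
apply: (tle0_iso _ (dec_lP D)); exists (dec_in D), s; split=> //.
apply: le_lift_uniq; first exact: dec_lP.
by rewrite hcompA sE hcomp_idl hcomp_idr.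
Qed.

Definition in_heart X : Prop := tle0 t X /\ tge0 t X.

Definition heart : lincat k := full_subcat in_heart.

Lemma tau_ge_le_heart X : in_heart (tau_ge (tau_le X)).
Proof.
split; last exact: dec_rP.
apply: tle0_orth => Y f tY; apply: ge_desc_uniq; first exact: tge_sub.
rewrite hcomp0l; exact: t_orth (dec_lP (le_dec X)) tY _.
Qed.

Definition H0 : functor T heart :=
  @Functor k T heart
    (fun X => exist in_heart (tau_ge (tau_le X)) (tau_ge_le_heart X))
    (fun X Y f => fmor (comp_fun tau_ge tau_le) f)
    (fmor_id (comp_fun tau_ge tau_le))
    (fun _ _ _ => @fmor_comp _ _ _ (comp_fun tau_ge tau_le) _ _ _)
    (@fmor_lin _ _ _ (comp_fun tau_ge tau_le)).

Definition Hn (n : int) X : heart := H0 (shiftn n X).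

Definition t_nondegenerate : Prop :=
  forall A : T, is_zero A <-> forall n : int, is_zero (Hn n A).

(* S is the derived projective associated to P. *)
Definition is_derived_projective_of (P : heart) (S : T) : Prop :=
  exists phi : forall X : T, Hom P (H0 X) -> Hom S X,
    [/\ forall X, linear (phi X), forall X, bijective (phi X)
      & forall X Y (f : Hom X Y) (u : Hom P (H0 X)),
          phi Y (fmor H0 f \co u) = f \co phi X u].

(* The objects of DGProj(T). *)
Definition derived_projective (X : T) : Prop :=
  exists P : heart, projective P /\
    exists S : T, is_derived_projective_of P S /\ isomorphic X S.

Definition has_derived_projectives : Prop :=
  forall P : heart, projective P -> exists S : T, is_derived_projective_of P S.

Definition has_enough_derived_projectives : Prop :=
  has_derived_projectives /\ enough_projectives heart.

End TStructure.
End Triangulated.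

(* Main.v *)
From mathcomp Require Import all_boot all_order all_algebra.
From mathcomp Require Import boolp.
Require Import Defs.

(** Write [S] for an object of the co-heart.  Since the co-t-structure is left
    adjacent, [S] lies in T_{<=0} and receives no nonzero map into T_{<=-1}.
    Hence, along the truncations of any [X],

      Hom(S, X) = Hom(S, tau_{<=0} X) = Hom(S, H^0 X) = Hom(H^0 S, H^0 X):

    the first equality holds because [S] is in T_{<=0}, the second because both
    tau_{<=-1} tau_{<=0} X and its shift are in T_{<=-1}, and the third because
    H^0 S is the reflection of [S] in T_{>=0} ([H0_reflection]).  So H^0 is
    bijective on maps out of the co-heart ([H0_coheart_faithful],
    [H0_coheart_full]), which says that [S] is the derived projective of H^0 S
    once H^0 S is known to be projective.  It is projective because the cone of
    an epimorphism of the heart lies in T_{<=-1}, and [S] has no map to it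
    ([H0_coheart_projective]).

    If [X] is in the heart, the weight triangle of [X] begins with a map
    [S -> X] from the co-heart whose cone is in T_{<=-1}; the induced map
    H^0 S -> X is an epimorphism ([coheart_epi]), so the heart has enough
    projectives.  When [X] is itself projective this epimorphism splits, the
    resulting idempotent of H^0 S lifts uniquely to [S], and a splitting of the
    lift in the co-heart is the derived projective of [X]
    ([derived_projective_in_coheart]).  Derived projectives corepresent a
    functor and so are unique up to isomorphism, which puts all of them in the
    co-heart. *)

Set Implicit Arguments.
Unset Strict Implicit.
Unset Printing Implicit Defensive.

Import GRing.Theory.
Local Open Scope ring_scope.

(** * Truncation and distinguished triangles *)

Section TruncationTriangles.
Variables (k : comPzRingType) (T : tricat k) (t : tstruct T).

Lemma tle_m1_sh (X : T) : tle0 t X -> tle t (-1) (sh T X).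
Proof. by move=> tX; exists X => //; apply: iso_refl. Qed.

Lemma tle_m1_tle0 (X : T) : tle t (-1) X -> tle0 t X.
Proof. exact: tle_sub. Qed.

Lemma tle_m1_hom_sh (X Y : T) (f : Hom X (sh T Y)) :
  tle t (-1) X -> tge t 1 Y -> f = 0.
Proof.
move=> [X' tX' [a [b [ba _]]]] tY.
have [g gE] := sh_full (f \co b).
have fb : f \co b = 0 by rewrite -gE (t_orth tX' tY g) fmor0.
by rewrite -[f]hcomp_idr -ba hcompA fb hcomp0l.
Qed.

Lemma tle0_cone (X Y Z : T) (f : Hom X Y) (g : Hom Y Z) (h : Hom Z (sh T X)) :
  dist f g h -> tle0 t X -> tle0 t Y -> tle0 t Z.
Proof.
move=> /dist_rot d tX tY; apply: tle0_orth => W u tW.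
have [|v <-] := dist_desc (u := u) d; first exact: t_orth tY tW _.
by rewrite (t_orth (tle_sh tX) tW v) hcomp0l.
Qed.

(** The object in question is an extension of [Y] by Z[-1]; testing against
    shifted maps avoids desuspending the triangle. *)
Lemma tle0_fiber (X Y Z : T) (f : Hom X Y) (g : Hom Y Z) (h : Hom Z (sh T X)) :
  dist f g h -> tle0 t Y -> tle t (-1) Z -> tle0 t X.
Proof.
move=> /dist_rot/dist_rot d tY tZ; apply: tle0_orth => W u tW.
apply: sh_faithful.
have [|v <-] := dist_desc (u := fmor (sh T) u) d; first exact: tle_m1_hom_sh.
by rewrite (tle_m1_hom_sh v (tle_m1_sh tY) tW) hcomp0l.
Qed.

Lemma tau_ge_heart (X : T) : tle0 t X -> in_heart t (dec_r (ge_dec t X)).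
Proof.
move=> tX; split; last exact: dec_rP.
apply: tle0_orth => Y f tY; apply: ge_desc_uniq; first exact: tge_sub.
by rewrite hcomp0l; apply: t_orth tX tY _.
Qed.

(** The cone [Z] is in T_{<=0}, so tau_{>=0} Z is its H^0, the cokernel of [e]
    in the heart, which vanishes because [e] is an epimorphism. *)
Lemma epi_cone_out0 (A B : heart t) (e : Hom A B) (Z : T)
    (g : Hom (sval B) Z) (h : Hom Z (sh T (sval A))) :
  epi e -> dist (e : Hom (sval A) (sval B)) g h -> dec_out (ge_dec t Z) = 0.
Proof.
move=> epi_e d; set q := dec_out _.
have hZ : in_heart t (dec_r (ge_dec t Z)).
  by apply/tau_ge_heart/(tle0_cone d); [case: (svalP A)|case: (svalP B)].
have qg : q \co g = 0.
  apply: (epi_e (exist _ _ hZ) (q \co g) 0).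
  rewrite /= in d *.
  by rewrite -hcompA (dist_comp0 d) hcomp0r hcomp0l.
have /dist_rot d' := d.
have [v <-] := dist_desc d' qg.
have [tA _] := svalP A.
by rewrite (tle_tge_m1 v (tle_m1_sh tA) (proj2 hZ)) hcomp0l.
Qed.

(** For [S] in T_{<=0} the canonical map [c] from [S] to H^0 S is the reflection
    of [S] in T_{>=0}.  The last clause is the naturality of [c], phrased for
    maps given through tau_{<=0}. *)
Lemma H0_reflection (S : T) : tle0 t S ->
  exists c : Hom S (sval (H0 t S)),
    [/\ forall Z (q : Hom S Z), tge0 t Z ->
          exists v : Hom (sval (H0 t S)) Z, v \co c = q,
        forall Z (v v' : Hom (sval (H0 t S)) Z), tge0 t Z ->
          v \co c = v' \co c -> v = v'
      & forall X (g : Hom S (dec_l (le_dec t X))),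
          (fmor (H0 t) (dec_in (le_dec t X) \co g)
             : Hom (sval (H0 t S)) (sval (H0 t X))) \co c
          = dec_out (ge_dec t (dec_l (le_dec t X))) \co g].
Proof.
move=> tS; set i := dec_in (le_dec t S).
(* tau_{<=0} S is S itself: s inverts the truncation map i. *)
have [s is1] := le_lift_exists (idmor S) tS.
have si1 : s \co i = idmor _.
  apply: le_lift_uniq; first exact: dec_lP.
  by rewrite hcompA is1 hcomp_idl hcomp_idr.
exists (dec_out (ge_dec t (dec_l (le_dec t S))) \co s); split=> /=.
- move=> Z q tZ.
  have [v vE] := ge_desc_exists (q \co i) tZ.
  by exists v; rewrite hcompA vE -hcompA is1 hcomp_idr.
- move=> Z v v' tZ; rewrite !hcompA => vs.
  apply: ge_desc_uniq => //.
  by rewrite -[LHS]hcomp_idr -[RHS]hcomp_idr -si1 !hcompA vs.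
- move=> X g; rewrite hcompA tau_ge_mapE -hcompA; congr (_ \co _).
  apply: le_lift_uniq => //.
  by rewrite hcompA tau_le_mapE -hcompA is1 hcomp_idr.
Qed.

End TruncationTriangles.

(** * Derived projectives as corepresenting objects *)

Section Corepresentation.
Variables (k : comPzRingType) (T : tricat k) (t : tstruct T).

(** The Yoneda argument: each identity map corresponds to a universal element,
    and each universal element yields a map between the two objects. *)
Lemma derived_projective_of_uniq (P : heart t) (S S' : T) :
  is_derived_projective_of P S -> is_derived_projective_of P S' ->
  isomorphic S S'.
Proof.
move=> [phi [_ phib phin]] [psi [_ psib psin]].
have [phi' phiK phi'K] := phib S; have [psi' psiK psi'K] := psib S'.
set u := phi' (idmor S); set v := psi' (idmor S').
have uE : phi S u = idmor S by rewrite phi'K.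
have vE : psi S' v = idmor S' by rewrite psi'K.
exists (phi S' v), (psi S u); split.
  rewrite -phin -[RHS]uE; congr (phi S _); apply: (bij_inj (psib S)).
  by rewrite psin vE hcomp_idr.
rewrite -psin -[RHS]vE; congr (psi S' _); apply: (bij_inj (phib S')).
by rewrite phin uE hcomp_idr.
Qed.

(** A map out of [P] is sent to the map out of [S] whose H^0 it is, after
    transport along [a]. *)
Lemma derived_projective_of_H0 (P : heart t) (S : T) (a : Hom (H0 t S) P) :
  is_isomor a ->
  (forall X (f g : Hom S X), fmor (H0 t) f = fmor (H0 t) g -> f = g) ->
  (forall X (u : Hom (H0 t S) (H0 t X)), exists f, fmor (H0 t) f = u) ->
  is_derived_projective_of P S.
Proof.
move=> [b [ba ab]] H0inj H0surj.
pose phi X (u : Hom P (H0 t X)) : Hom S X := sval (cid (H0surj X (u \co a))).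
have phiE X u : fmor (H0 t) (phi X u) = u \co a by rewrite /phi; case: cid.
exists phi; split.
- move=> X z u v; apply: H0inj.
  by rewrite fmor_lin !phiE hcomp_linl.
- move=> X; exists (fun f => fmor (H0 t) f \co b).
    by move=> u; rewrite phiE -hcompA ab hcomp_idr.
  by move=> f; apply: H0inj; rewrite phiE -hcompA ba hcomp_idr.
- by move=> X Y f u; apply: H0inj; rewrite fmor_comp !phiE hcompA.
Qed.

End Corepresentation.

(** * The co-heart of a left adjacent co-t-structure *)

Section LeftAdjacent.
Variables (k : comPzRingType) (T : tricat k) (t : tstruct T) (w : cotstruct T).
Hypothesis adj : left_adjacent t w.

Lemma in_coheart_iso (X Y : T) :
  isomorphic X Y -> in_coheart w X -> in_coheart w Y.
Proof.
by move=> iXY [geX leX]; split; [apply: wge0_iso geX|apply: wle0_iso leX].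
Qed.

Lemma coheart_tle0 (S : T) : in_coheart w S -> tle0 t S.
Proof. by case=> _ /adj. Qed.

Lemma wge0_tle_m1 (S Y : T) (f : Hom S Y) : wge0 w S -> tle t (-1) Y -> f = 0.
Proof. by move=> wS [Z /adj wZ iZ]; apply: w_orth wS _ _; exists Z. Qed.

Lemma H0_coheart_faithful (S X : T) (f g : Hom S X) : in_coheart w S ->
  fmor (H0 t) f = fmor (H0 t) g -> f = g.
Proof.
move=> hS fg; have tS := coheart_tle0 hS; have [wS _] := hS.
have [c [_ _ cn]] := H0_reflection tS.
have [u uE] := le_lift_exists f tS; have [v vE] := le_lift_exists g tS.
suff uv : u - v = 0 by rewrite -uE -vE (eqP (_ : u == v)) // -subr_eq0 uv.
set D := ge_dec t (dec_l (le_dec t X)).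
have [|r <-] := dist_lift (u := u - v) (dec_dist D).
  by rewrite hcompBr -!cn uE vE fg subrr.
by rewrite (wge0_tle_m1 r wS (dec_lP D)) hcomp0r.
Qed.

Lemma H0_coheart_full (S X : T) (u : Hom (H0 t S) (H0 t X)) :
  in_coheart w S -> exists f : Hom S X, fmor (H0 t) f = u.
Proof.
move=> hS; have tS := coheart_tle0 hS; have [wS _] := hS.
have [c [_ cu cn]] := H0_reflection tS.
set D := ge_dec t (dec_l (le_dec t X)).
have /dist_rot d := dec_dist D.
have tD : tle t (-1) (sh T (dec_l D)).
  by apply/tle_m1_sh/tle_m1_tle0; apply: dec_lP.
have [|g gE] := dist_lift (u := (u : Hom (sval (H0 t S)) (dec_r D)) \co c) d;
  first exact: wge0_tle_m1.
exists (dec_in (le_dec t X) \co g); apply: cu; first exact: dec_rP.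
by rewrite cn gE.
Qed.

Lemma H0_coheart_projective (S : T) : in_coheart w S -> projective (H0 t S).
Proof.
move=> hS A B e epi_e f; have tS := coheart_tle0 hS; have [wS _] := hS.
have [c [ce cu _]] := H0_reflection tS.
have [Z [g [h d]]] := dist_cone (e : Hom (sval A) (sval B)).
have S_Z0 (r : Hom S Z) : r = 0.
  have [|s <-] := dist_lift (u := r) (dec_dist (ge_dec t Z)).
    by rewrite (epi_cone_out0 epi_e d) hcomp0l.
  by rewrite (wge0_tle_m1 s wS (dec_lP (ge_dec t Z))) hcomp0r.
have [v vE] := dist_lift d (S_Z0 (g \co ((f : Hom _ (sval B)) \co c))).
have [_ geA] := svalP A; have [_ geB] := svalP B.
have [v' v'E] := ce _ v geA.
exists v'; apply: cu => //=.
by rewrite -hcompA v'E.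
Qed.

Lemma coheart_derived_projective_of (P : heart t) (S : T)
    (a : Hom (H0 t S) P) :
  in_coheart w S -> is_isomor a -> is_derived_projective_of P S.
Proof.
move=> hS ai; apply: (derived_projective_of_H0 ai) => X.
  by move=> f g; apply: H0_coheart_faithful.
by move=> u; apply: H0_coheart_full.
Qed.

(** The weight triangle S -> X -> C of [X] has [C] in T_{<=-1}, so [S] is in
    T_{<=0}, and maps from [X] to T_{>=0} are determined by their restriction
    to [S]. *)
Lemma coheart_epi (X : heart t) :
  exists2 S : T, in_coheart w S & exists e : Hom (H0 t S) X, epi e.
Proof.
have [leX geX] := svalP X.
have [[S C f g h wS [C' /adj tC' iC] d]] := w_dec w (sval X).
have tC : tle t (-1) C by exists C'.
have tS : tle0 t S := tle0_fiber d leX tC.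
exists S; first by split=> //; apply/adj.
have [c [ce _ _]] := H0_reflection tS.
have [e eE] := ce _ f geX.
exists e => Z u v /= uv; have [_ geZ] := svalP Z.
apply/eqP; rewrite -subr_eq0; apply/eqP.
have [|r rE] := dist_desc (u := (u - v : Hom (sval X) (sval Z))) d.
  by rewrite hcompBl -eE !hcompA uv subrr.
by rewrite /= -rE (tle_tge_m1 r tC geZ) hcomp0l.
Qed.

Lemma heart_enough_projectives : enough_projectives (heart t).
Proof.
move=> X; have [S hS [e epi_e]] := coheart_epi X.
by exists (H0 t S), e; split=> //; apply: H0_coheart_projective.
Qed.

Lemma derived_projective_in_coheart (P : heart t) :
  idempotent_complete (coheart w) -> projective P ->
  exists2 S : T, in_coheart w S & is_derived_projective_of P S.
Proof.
move=> idc projP; have [S hS [e epi_e]] := coheart_epi P.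
have [r er] := projP _ _ e epi_e (idmor P).
have [z zE] := H0_coheart_full (r \co e) hS.
have zz : z \co z = z.
  apply: (H0_coheart_faithful hS).
  by rewrite fmor_comp zE hcompA -(hcompA r) er hcomp_idr.
have [[S' hS'] [i [p []]]] := idc (exist _ S hS) z zz.
move: i p => /= i p pi1 ipz.
exists S' => //.
apply: (coheart_derived_projective_of (a := e \co fmor (H0 t) i) hS').
have H0ip : fmor (H0 t) i \co fmor (H0 t) p = r \co e.
  by rewrite -fmor_comp ipz zE.
have H0pi : fmor (H0 t) p \co fmor (H0 t) i = idmor (H0 t S').
  by rewrite -fmor_comp pi1 fmor_id.
exists (fmor (H0 t) p \co r); split.
  rewrite hcompA -(hcompA _ r) -H0ip -!hcompA H0pi hcomp_idr.
  exact: H0pi.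
by rewrite hcompA -(hcompA e) H0ip hcompA er hcomp_idl er.
Qed.

End LeftAdjacent.

Theorem theoremA6 (k : comPzRingType) (T : tricat k) (t : tstruct T)
    (w : cotstruct T) :
  t_nondegenerate t -> left_adjacent t w -> idempotent_complete (coheart w) ->
  has_enough_derived_projectives t /\
  (forall X : T, derived_projective t X <-> in_coheart w X).
Proof.
move=> _ adj idc; split; first split.
- move=> P projP.
  by have [S _ PS] := derived_projective_in_coheart adj idc projP; exists S.
- exact: heart_enough_projectives adj.
move=> X; split=> [[P [projP [S [PS iXS]]]]|hX].
  have [S' hS' PS'] := derived_projective_in_coheart adj idc projP.
  apply: in_coheart_iso hS'.
  exact: iso_trans (derived_projective_of_uniq PS' PS) (iso_sym iXS).
exists (H0 t X); split; first exact: H0_coheart_projective adj _ hX.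
exists X; split; last exact: iso_refl.
exact: coheart_derived_projective_of adj _ _ _ hX (idm_iso _).
Qed.
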